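(* Let $q \ge 2$ and $n \ge 1$ be integers, and let $C \subseteq H_q^n$ be an equidistant code with distance $d$. Assume that $d \neq \frac{(q-1)n+1}{q}$. Then $$|C| \le n(q-1).$$
   Context: $H_q^n = \{0,1,\ldots,q-1\}^n$ is the $q$-ary Hamming space, with Hamming distance $\mathrm{d_H}(x,y) = |\{i \in \{1,\ldots,n\} : x(i) \neq y(i)\}|$, where $x(i)$ is the $i$-th coordinate of $x$. An equidistant code with distance $d$ is a set $C \subseteq H_q^n$ whose pairwise Hamming distances between distinct codewords take exactly one value, and this value is $d$ (so $|C|\ge 2$ and $d \ge 1$). *)

(* Defs.v *)
From mathcomp Require Import all_boot all_order all_algebra.
Set Implicit Arguments.
Unset Strict Implicit.
Unset Printing Implicit Defensive.

Definition hamming_space (q n : nat) := {ffun 'I_n -> 'I_q}.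

Definition dH (q n : nat) (x y : hamming_space q n) : nat :=
  #|[set i | x i != y i]|.

(* The set of distances between distinct codewords is exactly {d}; the
   right-to-left direction says that d is attained, so a code with at most one
   codeword is not equidistant. *)
Definition equidistant (q n : nat) (C : {set hamming_space q n}) (d : nat) : Prop :=
  forall k : nat,
    (exists x y, [/\ x \in C, y \in C, x != y & dH x y = k]) <-> k = d.

(* Main.v *)
(** Replace the symbol [b] by the centred indicator vector [e_b - 1/q], so that
    codewords become vectors in a space of dimension [n(q-1)] whose Gram matrix
    is [d I + c J] with [c = n - d - n/q].  Among [n(q-1) + 1] codewords there is
    a linear dependence, so this matrix is singular; as [d] is nonzero, this
    forces [d + c (n(q-1) + 1) = 0], that is, [d = (n(q-1) + 1)/q]. *)
Require Import Defs.
From mathcomp Require Import all_boot all_order all_algebra ring.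
Import GRing.Theory Num.Theory.
Local Open Scope ring_scope.

Lemma linear_dependence (F : fieldType) (T : finType) (m : nat)
    (A : 'I_m -> T -> F) :
  (#|T| < m)%N ->
  exists2 u : 'I_m -> F, exists k, u k != 0
    & forall t, \sum_k u k * A k t = 0.
Proof.
move=> ltTm; pose M : 'M[F]_(m, #|T|) := \matrix_(k, j) A k (enum_val j).
have : kermx M != 0.
  rewrite kermx_eq0 /row_free neq_ltn.
  by rewrite (leq_ltn_trans (rank_leq_col M) ltTm).
case/rowV0Pn=> v /sub_kermxP vM0 /rV0Pn nz_v.
exists (fun k => v 0 k) => // t.
have /matrixP/(_ 0 (enum_rank t)) := vM0; rewrite !mxE; apply: etrans.
by apply: eq_bigr => k _; rewrite mxE enum_rankK.
Qed.

Lemma sum_agree (R : pzRingType) (q n : nat) (x y : hamming_space q n) :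
  \sum_i (x i == y i)%:R = n%:R - (dH x y)%:R :> R.
Proof.
apply/eqP; rewrite eq_sym subr_eq -natr_sum -natrD; apply/eqP; congr _%:R.
rewrite /dH -sum1dep_card [X in (_ + X)%N]big_mkcond -big_split /=.
rewrite -[LHS]card_ord -sum1_card.
by apply: eq_bigr => i _; case: (x i == y i).
Qed.

(** At each position the [q.+1] centred coordinates of a word sum to zero, so those of the [q]
    nonzero symbols determine the remaining one. Hence [n * q] equations suffice, not [n * q.+1]. *)
Lemma centred_dependence (F : numFieldType) (q n m : nat)
    (s : 'I_m -> hamming_space q.+1 n) :
  (n * q < m)%N ->
  exists2 u : 'I_m -> F, exists k, u k != 0
    & forall i b, \sum_k u k * ((s k i == b)%:R - q.+1%:R^-1) = 0.
Proof.
move=> ltm; pose g k i b : F := (s k i == b)%:R - q.+1%:R^-1.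
have [|u nz_u u0] := @linear_dependence F ('I_n * 'I_q)%type m
    (fun k t => g k t.1 (lift ord0 t.2)).
  by rewrite card_prod !card_ord.
exists u => // i b; rewrite -/(g _ _ _).
have sum_g k : \sum_b g k i b = 0.
  rewrite sumrB sumr_const card_ord -[X in _ - X]mulr_natl divff ?pnatr_eq0 //.
  rewrite (bigD1 (s k i)) //= eqxx big1 ?addr0 ?subrr // => a.
  by rewrite eq_sym => /negPf->.
case: (unliftP ord0 b) => [a|] ->; first exact: (u0 (i, a)).
(* The coordinate of the symbol 0 is minus the sum of the other ones. *)
have : \sum_b \sum_k u k * g k i b = 0.
  rewrite exchange_big big1 // => k _.
  by rewrite -mulr_sumr sum_g mulr0.
by rewrite big_ord_recl [X in _ + X]big1 ?addr0 // => a _; exact: (u0 (i, a)).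
Qed.

(** Summing the equations over [j] gives [(a + c * m) * S = 0] with [S] the sum of [u]; if [S]
    vanished, each equation would reduce to [a * u j = 0]. *)
Lemma scaled_identity_add_const_singular (F : fieldType) (m : nat) (a c : F)
    (u : 'I_m -> F) :
  a != 0 -> (exists k, u k != 0) ->
  (forall j, a * u j + c * \sum_k u k = 0) ->
  a + c * m%:R = 0.
Proof.
move=> a0 [k uk0] uE; set S := \sum_k u k in uE.
have S0 : S != 0.
  apply: contraNneq uk0 => S0; have /eqP := uE k.
  by rewrite S0 mulr0 addr0 mulf_eq0 (negPf a0).
apply: (mulIf S0); rewrite mul0r.
have : \sum_j (a * u j + c * S) = 0 by rewrite big1.
rewrite big_split /= -mulr_sumr sumr_const card_ord -/S => aScS.
by rewrite mulrDl mulrAC mulr_natr.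
Qed.

Lemma equidistant_family_distance (q n d : nat)
    (s : 'I_(n * q).+1 -> hamming_space q.+1 n) :
  (0 < n)%N -> (0 < q)%N -> (0 < d)%N ->
  (forall j k, j != k -> dH (s j) (s k) = d) ->
  d%:R = (n * q).+1%:R / q.+1%:R :> rat.
Proof.
move=> n0 q0 d0 sd.
have [u nz_u u0] := centred_dependence rat _ _ _ s (ltnSn _).
pose c : rat := n%:R - d%:R - n%:R / q.+1%:R.
(* This is the inner product of the centred vectors of [s k] and [s j]: at each position the first
   sums to zero over the symbols, so pairing it with the second just evaluates it at the symbol
   [s j i]. *)
have gram j k : \sum_i ((s k i == s j i)%:R - q.+1%:R^-1)
    = d%:R * (k == j)%:R + c :> rat.
  rewrite sumrB sum_agree sumr_const card_ord -[X in _ - X]mulr_natl /c.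
  have [->|/sd->] := eqVneq k j; last by rewrite mulr0 add0r.
  suff -> : dH (s j) (s j) = 0%N by rewrite mulr1; ring.
  by apply/eqP; rewrite cards_eq0; apply/eqP/setP => i; rewrite !inE eqxx.
have d0' : d%:R != 0 :> rat by rewrite pnatr_eq0 -lt0n.
have : d%:R + c * (n * q).+1%:R = 0.
  apply: scaled_identity_add_const_singular _ _ _ _ _ d0' nz_u _ => j.
  transitivity (\sum_i \sum_k u k * ((s k i == s j i)%:R - q.+1%:R^-1)); last first.
    by rewrite big1.
  rewrite exchange_big /=.
  under [RHS]eq_bigr => k _ do rewrite -mulr_sumr gram mulrDr mulrC [u k * c]mulrC.
  rewrite big_split /= -mulr_sumr; congr (_ + _).
  rewrite (bigD1 j) //= eqxx mulr1 big1 ?addr0 // => k /negPf->.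
  by rewrite mulr0 mul0r.
have n0' : n%:R != 0 :> rat by rewrite pnatr_eq0 -lt0n.
have q0' : q%:R != 0 :> rat by rewrite pnatr_eq0 -lt0n.
have Q0 : 1 + q%:R != 0 :> rat by rewrite nat1r pnatr_eq0.
rewrite /c -!natr1 natrM => e.
apply/eqP; rewrite -subr_eq0; apply/eqP.
(* The left side of [e] is [- n * q] times the difference to be shown zero. *)
apply: (mulfI (mulf_neq0 n0' q0')); rewrite mulr0 -[RHS]oppr0 -[in RHS]e.
by field; rewrite // addrC.
Qed.

Theorem theorem6 (q n d : nat) (C : {set hamming_space q n})
    (hq : (2 <= q)%N) (hn : (1 <= n)%N)
    (hC : equidistant C d)
    (hd : (d%:R : rat) <> ((q%:R - 1) * n%:R + 1) / q%:R) :
  (#|C| <= n * (q - 1))%N.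
Proof.
(* From here on the alphabet has [q.+1] symbols, and the bound to contradict is [n * q]. *)
case: q => [//|q] in C hq hC hd *; rewrite subn1 /= leqNgt; apply/negP => ltC.
case: hd; have -> : (q.+1%:R - 1) * n%:R + 1 = (n * q).+1%:R :> rat.
  by rewrite -!natr1 natrM; ring.
pose s (k : 'I_(n * q).+1) := enum_val (widen_ord ltC k).
have d0 : (0 < d)%N.
  have [_ /(_ erefl)[x [y [_ _ neq_xy <-]]]] := hC d.
  rewrite card_gt0; apply: contraNneq neq_xy => e0; apply/eqP/ffunP => i.
  by apply/eqP; have := in_set0 i; rewrite -e0 inE => /negbFE.
apply: (@equidistant_family_distance q n d s) => // j k neq_jk.
apply: (proj1 (hC _)); exists (s j), (s k); split=> //; try exact: enum_valP.
by apply: contraNneq neq_jk => /enum_val_inj/(congr1 val)/= /val_inj->.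
Qed.
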